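(* Let $\{M(t)\}_{t\ge0}$ be the generalized counting process with rates $\lambda_1,\dots,\lambda_k>0$, $\Lambda=\lambda_1+\cdots+\lambda_k$, let $\{D_f(t)\}_{t\ge0}$ be an independent Lévy subordinator with Bernstein function $f$, and let $M_f(t)=M(D_f(t))$. For $n\ge1$ let $T_f^n=\inf\{s\ge0:M_f(s)\ge n\}$. Then the density function $\mathscr{P}_{f}(n,s)=\Pr\{T_{f}^{n}\in \mathrm{d}s\}/\mathrm{d}s$ of $T_f^n$ is $$\mathscr{P}_{f}(n,s)=-\frac{\mathrm{d}}{\mathrm{d}s}\sum_{l=0}^{n-1}\sum_{\Omega(k,l)}\left(\prod_{j=1}^{k}\frac{(-\lambda_{j})^{x_{j}}}{x_{j}!}\right)\frac{\mathrm{d}^{z_{k}}}{\mathrm{d}\Lambda^{z_{k}}}e^{-sf(\Lambda)},$$ where $z_k=x_1+\cdots+x_k$.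
   Context: Generalized counting process (GCP): the (càdlàg) Lévy process $\{M(t)\}_{t\ge0}$ with values in the non-negative integers, $M(0)=0$, and $\Pr\{M(t)=n\}=\sum_{\Omega(k,n)}\prod_{j=1}^{k}\frac{(\lambda_{j}t)^{x_{j}}}{x_{j}!}e^{-\Lambda t}$, where $\Omega(k,n)=\{(x_1,\dots,x_k): x_j\in\{0,1,2,\dots\},\ \sum_{j=1}^k jx_j=n\}$. Lévy subordinator: a (finite-valued, càdlàg) non-decreasing Lévy process with $\mathbb{E}(e^{-sD_f(t)})=e^{-tf(s)}$, where $f(s)=c_2s+\int_0^\infty(1-e^{-sx})\,\overline\nu(\mathrm{d}x)$, $c_2\ge0$, $\int_0^\infty(x\wedge1)\,\overline\nu(\mathrm{d}x)<\infty$, so that $f(0)=0$. The derivative $\frac{\mathrm{d}^{z}}{\mathrm{d}\Lambda^{z}}$ is the ordinary derivative of the one-variable function $\Lambda\mapsto e^{-sf(\Lambda)}$, with the $\lambda_j$ in the product held fixed, evaluated at $\Lambda=\lambda_1+\cdots+\lambda_k$. *)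

(* Defs.v *)
From HB Require Import structures.
From mathcomp Require Import all_boot all_order all_algebra.
From mathcomp Require Import all_classical all_reals all_analysis.
From mathcomp Require Import measurable_realfun.

Set Implicit Arguments.
Unset Strict Implicit.
Unset Printing Implicit Defensive.

Import Order.TTheory GRing.Theory Num.Theory.
Import numFieldNormedType.Exports.

Local Open Scope classical_set_scope.
Local Open Scope ring_scope.

(* Stochastic processes are functions X : R -> T -> R of which only the times
   t >= 0 are meaningful; nothing is assumed about negative times. *)
Section processes.
Context d (T : measurableType d) (R : realType) (P : probability T R).
Implicit Types X Y : R -> T -> R.

(* Taking some of the B i to be setT gives the product rule over subfamilies. *)
Definition mutually_independent m (X : 'I_m -> T -> R) : Prop :=
  forall B : 'I_m -> set R, (forall i, measurable (B i)) ->
    P (\bigcap_(i in [set: 'I_m]) (X i @^-1` B i)) =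
    (\prod_(i < m) P (X i @^-1` B i))%E.

Definition process_sigma X : set (set T) :=
  <<s [set A | exists t (B : set R),
         [/\ 0 <= t, measurable B & A = X t @^-1` B]] >>.

Definition independent_processes X Y : Prop :=
  forall A B, process_sigma X A -> process_sigma Y B ->
    P (A `&` B) = (P A * P B)%E.

Definition cadlag (x : R -> R) : Prop :=
  (forall t, 0 <= t -> x s @[s --> t^'+] --> x t) /\
  (forall t, 0 < t -> exists l : R, x s @[s --> t^'-] --> l).

Record levy_process X : Prop := LevyProcess {
  levy_measurable : forall t, 0 <= t -> measurable_fun setT (X t) ;
  levy_start : forall w, X 0 w = 0 ;
  levy_independent : forall m (t : nat -> R), 0 <= t 0%N ->
    {homo t : i j / (i <= j)%N >-> i <= j} ->
    mutually_independent (fun (i : 'I_m) w => X (t i.+1) w - X (t i) w) ;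
  levy_stationary : forall s t (B : set R), 0 <= s -> 0 <= t -> measurable B ->
    P ((fun w => X (s + t) w - X s w) @^-1` B) = P (X t @^-1` B) ;
  levy_cadlag : forall w, cadlag (X ^~ w) }.

(* Law of a possibly infinite random variable: g is its Lebesgue density on the
   real line. Its total mass is the probability that Z is finite. *)
Definition has_density (Z : T -> \bar R) (g : R -> R) : Prop :=
  [/\ measurable_fun setT Z,
      measurable_fun setT g,
      forall x, 0 <= g x &
      forall A : set R, measurable A ->
        P (Z @^-1` (EFin @` A)) =
        (\int[@lebesgue_measure R]_(x in A) (g x)%:E)%E].

End processes.

(* The solutions x of 1 x_1 + ... + k x_k = n; the coordinate x_j is x i with
   j = i.+1. Every coordinate of a solution is at most n (Omega_bound), so that
   the range 'I_n.+1 loses none. *)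
Definition Omega (k n : nat) : {set {ffun 'I_k -> 'I_n.+1}} :=
  [set x : {ffun 'I_k -> 'I_n.+1} | (\sum_(i < k) i.+1 * x i == n)%N].

Lemma Omega_bound (k n : nat) (x : 'I_k -> nat) :
  (\sum_(i < k) i.+1 * x i = n)%N -> forall i, (x i < n.+1)%N.
Proof.
move=> <- i; rewrite ltnS (bigD1 i) //=; apply: leq_trans (leq_addr _ _).
by rewrite leq_pmull.
Qed.

Section gcp.
Context d (T : measurableType d) (R : realType) (P : probability T R).

Record generalized_counting_process (k : nat) (lam : 'I_k -> R)
    (M : R -> T -> nat) : Prop := GeneralizedCountingProcess {
  gcp_levy : levy_process P (fun t w => (M t w)%:R) ;
  gcp_law : forall t n, 0 <= t ->
    P [set w | M t w = n] =
    (\sum_(x in Omega k n)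
       (\prod_(j < k) ((lam j * t) ^+ x j / (x j)`!%:R)) *
       expR (- ((\sum_(j < k) lam j) * t)))%:E }.

(* Bernstein function of a Levy subordinator, without killing term. Only its
   values on the half-line s >= 0 are constrained. *)
Definition bernstein_function (f : R -> R) : Prop :=
  exists (c : R) (nu : {measure set (measurableTypeR R) -> \bar R}),
    [/\ 0 <= c,
        (\int[nu]_(x in `]0%R, +oo[) (Num.min x 1)%:E < +oo)%E &
        forall s, 0 <= s ->
          (f s)%:E = ((c * s)%:E +
            \int[nu]_(x in `]0%R, +oo[) (1 - expR (- (s * x)))%:E)%E].

Record levy_subordinator (f : R -> R) (D : R -> T -> R) : Prop :=
  LevySubordinator {
  subordinator_levy : levy_process P D ;
  subordinator_nondecreasing : forall w s t, 0 <= s -> s <= t ->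
    D s w <= D t w ;
  subordinator_bernstein : bernstein_function f ;
  subordinator_laplace : forall s t, 0 <= s -> 0 <= t ->
    ('E_P[fun w => expR (- (s * D t w))])%E = (expR (- (t * f s)))%:E }.

Definition time_changed (M : R -> T -> nat) (D : R -> T -> R) : R -> T -> nat :=
  fun t w => M (D t w) w.

(* The infimum of the empty set is +oo. *)
Definition first_passage (N : R -> T -> nat) (n : nat) : T -> \bar R :=
  fun w => ereal_inf (EFin @` [set s | 0 <= s /\ (n <= N s w)%N]).

End gcp.

(* The double sum whose derivative in s is, up to sign, the density. It equals
   P(M_f(s) < n) for s >= 0. The rates lam j in the product are constants: only
   the argument L of f is differentiated. *)
Definition passage_sum (R : realType) (k : nat) (lam : 'I_k -> R) (f : R -> R)
    (n : nat) (s : R) : R :=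
  \sum_(l < n) \sum_(x in Omega k l)
    (\prod_(j < k) ((- lam j) ^+ x j / (x j)`!%:R)) *
    derive1n (\sum_(j < k) x j)%N (fun L => expR (- (s * f L)))
      (\sum_(j < k) lam j).

(* Main.v *)
Require Import Defs.
From HB Require Import structures.
From mathcomp Require Import all_boot all_order all_algebra.
From mathcomp Require Import all_classical all_reals all_analysis.
From mathcomp Require Import measurable_realfun ring lra.

Set Implicit Arguments.
Unset Strict Implicit.
Unset Printing Implicit Defensive.

Import Order.TTheory GRing.Theory Num.Theory.
Import numFieldNormedType.Exports.

Local Open Scope classical_set_scope.
Local Open Scope ring_scope.

(** Along a nondecreasing right-continuous path, the passage time T exceeds s
    exactly when M(D(s)) < n. Hence the survival function of T is
    s |-> P(M(D(s)) < n), and its negated derivative is the density.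

    Conditioning on D(s) gives
    P(M(D(s)) < n) = E (P(M(t) < n) at t = D(s)), a sum of terms
    E (D(s)^z exp (- L D(s))), where L is the total rate; up to the sign
    (-1)^z each is the z-th derivative of E exp (- L D(s)) = exp (- s f(L)) in
    L. This is the passage sum (passage_sumE, time_changed_cdf,
    first_passage_survival). The evaluation of the law of M at the independent
    random time D(s) needs no joint measurability of M: right continuity allows
    D(s) to be replaced by a countably valued time on its right
    (probability_random_time). Monotonicity of M is not part of its definition
    and holds almost surely, because its increments are distributed as values
    of M, which are nonnegative (gcp_nondecreasing).

    For regularity, the derivatives of f are polynomials in the moments
    E ((- D(1))^m exp (- L D(1))) and in 1 / E exp (- L D(1)). Therefore every
    L-derivative of exp (- s f(L)) is exp (- s f(L)) times a polynomial in s,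
    for all real s (derive1n_expR_laplace_exponent), and so is the passage sum
    (passage_sum_horner). It is thus continuously differentiable, which gives
    the density through the uniqueness of measures and the fundamental theorem
    of calculus (has_density_survival), and it tends to 0 as s grows when
    f(L) > 0 (exp_poly_bounded, laplace_exponent_gt0), so that T is then
    almost surely finite. *)

(** * Moments weighted by a decaying exponential *)

(** For m > 0 the bound is the m-th power of u <= exp u at u = a y / m. *)
Lemma exprn_expR_bound (R : realType) m (a y : R) : 0 < a -> 0 <= y ->
  y ^+ m * expR (- (a * y)) <= (m%:R / a) ^+ m.
Proof.
move=> a0 y0; case: m => [|m].
  by rewrite !expr0 mul1r -expR0 ler_expR oppr_le0 mulr_ge0// ltW.
set k := m.+1; have k0 : 0 < k%:R :> R by rewrite ltr0n.
rewrite expRN ler_pdivrMr ?expR_gt0//.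
have -> : a * y = k%:R * (a * y / k%:R) by rewrite mulrCA divff ?mulr1// gt_eqF.
rewrite expRM_natl -exprMn lerXn2r ?nnegrE ?mulr_ge0 ?invr_ge0 ?expR_ge0 ?(ltW a0)//.
have {1}-> : y = k%:R / a * (a * y / k%:R) by field; rewrite !gt_eqF.
apply: ler_wpM2l; first by rewrite divr_ge0// ltW.
by apply: le_trans (expR_ge1Dx _); rewrite lerDr.
Qed.

Lemma is_derive_expRM (R : realType) (y x : R) :
  is_derive x 1 (fun x : R => expR (- (x * y))) (- y * expR (- (x * y))).
Proof.
have dl : is_derive x 1 (fun x : R => - (x * y)) (- y).
  have -> : (fun x : R => - (x * y)) = - y \*: (@id R).
    by apply/funext => z; rewrite /= /GRing.scale /= mulNr mulrC.
  by apply: is_derive_eq; rewrite /GRing.scale /= mulr1.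
rewrite mulrC.
exact: (@is_derive1_comp _ expR (fun x : R => - (x * y))).
Qed.

Section laplace_moments.
Context d (T : measurableType d) (R : realType) (P : probability T R).
Variable Y : T -> R.
Hypotheses (mY : measurable_fun setT Y) (Y_ge0 : forall w, 0 <= Y w).

Definition laplace_moment m L : R :=
  \int[P]_(w in [set: T]) ((- Y w) ^+ m * expR (- (L * Y w))).

Lemma laplace_integrand_bound m a L w : 0 < a -> a <= L ->
  `|(- Y w) ^+ m * expR (- (L * Y w))| <= (m%:R / a) ^+ m.
Proof.
move=> a0 aL; rewrite normrM normrX normrN (ger0_norm (Y_ge0 _)).
rewrite (ger0_norm (expR_ge0 _)).
apply: le_trans (exprn_expR_bound m a0 (Y_ge0 w)).
rewrite ler_wpM2l ?exprn_ge0// ler_expR lerN2.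
exact: ler_wpM2r.
Qed.

Lemma measurable_laplace_integrand m L :
  measurable_fun [set: T] (fun w => (- Y w) ^+ m * expR (- (L * Y w))).
Proof.
apply: measurable_funM.
  by apply: measurable_funX; exact: measurableT_comp.
apply: measurableT_comp => //; apply: measurableT_comp => //.
exact: measurable_funM.
Qed.

Lemma integrable_laplace m L : 0 < L ->
  P.-integrable [set: T]
    (EFin \o (fun w => (- Y w) ^+ m * expR (- (L * Y w)))).
Proof.
move=> L0; apply: (@le_integrable _ _ _ P _ measurableT _
    (EFin \o cst ((m%:R / L) ^+ m))).
- by apply/measurable_EFinP; exact: measurable_laplace_integrand.
- move=> w _ /=; rewrite lee_fin [leRHS]ger0_norm ?exprn_ge0 ?divr_ge0 ?(ltW L0)//.
  exact: laplace_integrand_bound.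
- exact: finite_measure_integrable_cst.
Qed.

(** Differentiation under the expectation: for x > L / 2 the integrand of the
    next moment is bounded, uniformly in x and w, by the constant of
    exprn_expR_bound at a = L / 2, and constants are integrable. *)
Lemma is_derive_laplace_moment m (L : R) : 0 < L ->
  is_derive L 1 (laplace_moment m) (laplace_moment m.+1 L).
Proof.
move=> L0.
have L20 : 0 < L / 2 by rewrite divr_gt0.
pose F (x : R) w : R := (- Y w) ^+ m * expR (- (x * Y w)).
have dF (x : R) w : is_derive x 1 (F ^~ w) ((- Y w) ^+ m.+1 * expR (- (x * Y w))).
  rewrite exprSr -mulrA.
  exact: (@is_deriveZ _ _ _ _ ((- Y w) ^+ m) _ _ _ (is_derive_expRM (Y w) x)).
have d1F (x : R) w : partial1of2 F x w = (- Y w) ^+ m.+1 * expR (- (x * Y w)).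
  by rewrite partial1of2E; have [_] := dF x w.
(* Any neighbourhood of L that stays away from 0 would do. *)
pose I := `](L / 2), (L + 1)[%classic.
have I_L : I L by rewrite /I /= in_itv /=; apply/andP; split; lra.
have I_gt x : I x -> L / 2 <= x by rewrite /I /= in_itv => /andP[/ltW].
have int_F x : I x -> P.-integrable setT (EFin \o F x).
  by move=> /I_gt xL; apply: integrable_laplace; exact: lt_le_trans xL.
pose G (w : T) : R := (m.+1%:R / (L / 2)) ^+ m.+1.
have intG : P.-integrable setT (EFin \o G).
  exact: finite_measure_integrable_cst.
have dFx x w : I x -> [set: T] w -> derivable (F ^~ w) x 1.
  by move=> _ _; have [] := dF x w.
have bF x w : I x -> [set: T] w -> `|partial1of2 F x w| <= G w.
  by move=> /I_gt xL _; rewrite d1F; exact: laplace_integrand_bound.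
have G0 w : 0 <= G w by rewrite /G exprn_ge0// divr_ge0// ltW.
have dI := derivable_under_integral measurableT I_L int_F dFx G0 intG bF.
have := differentiation_under_integral measurableT I_L int_F dFx G0 intG bF.
rewrite derive1E => DI; apply: DeriveDef; first exact: dI.
by rewrite /laplace_moment DI; apply: eq_Rintegral => w _; rewrite d1F.
Qed.

End laplace_moments.

(** * Polynomials times exponentials *)

Section exponential_polynomial.
Variables (R : realType) (p : {poly R}) (a : R).

Lemma is_derive_exp_poly (s : R) :
  is_derive s 1 (fun s => p.[s] * expR (- (s * a)))
    ((p^`() - a *: p).[s] * expR (- (s * a))).
Proof.
have := is_deriveM (is_derive_poly p s) (is_derive_expRM a s).
rewrite /GRing.scale /= hornerD hornerN hornerZ.
by congr is_derive; ring.
Qed.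

Lemma continuous_exp_poly (q : {poly R}) :
  continuous (fun s : R => q.[s] * expR (- (s * a))).
Proof.
move=> s; apply: cvgM; first exact: continuous_horner.
apply: continuous_comp; last exact: continuous_expR.
by apply: cvgN; apply: cvgM; [exact: cvg_id|exact: cvg_cst].
Qed.

(** Applied to 'X * p, this gives the decay of order 1 / s of
    p.[s] * exp (- a s). *)
Lemma exp_poly_bounded : 0 < a ->
  exists C, forall s, 0 <= s -> p.[s] * expR (- (s * a)) <= C.
Proof.
move=> a0; exists (\sum_(i < size p) `|p`_i| * (i%:R / a) ^+ i) => s s0.
rewrite horner_coef mulr_suml; apply: ler_sum => i _.
rewrite -mulrA (mulrC s); apply: (@le_trans _ _ (`|p`_i| * (s ^+ i * expR (- (a * s))))).
  by rewrite ler_wpM2r ?ler_norm// mulr_ge0 ?exprn_ge0 ?expR_ge0.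
by rewrite ler_wpM2l// exprn_expR_bound.
Qed.

End exponential_polynomial.

(** * Smoothness of exponentials of a Laplace exponent *)

Section laplace_exponent.
Variables (R : realType) (phi : nat -> R -> R).
Hypothesis phi_derive : forall m (L : R), 0 < L ->
  is_derive L 1 (phi m) (phi m.+1 L).
Hypothesis phi_gt0 : forall L, 0 < L -> 0 < phi 0%N L.

(** The functions h s L of the time s and of the Laplace variable L that are
    polynomial in s, in the phi m L and in 1 / phi 0 L. With phi m L the m-th
    derivative of the Laplace transform phi 0, they form an algebra that is
    stable under differentiation in L and contains f' = - phi 1 / phi 0. *)
Inductive moment_poly : (R -> R -> R) -> Prop :=
| MomentConst c : moment_poly (fun _ _ => c)
| MomentTime : moment_poly (fun s _ => s)
| MomentPhi m : moment_poly (fun _ L => phi m L)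
| MomentInv : moment_poly (fun _ L => (phi 0%N L)^-1)
| MomentAdd h1 h2 : moment_poly h1 -> moment_poly h2 ->
    moment_poly (fun s L => h1 s L + h2 s L)
| MomentMul h1 h2 : moment_poly h1 -> moment_poly h2 ->
    moment_poly (fun s L => h1 s L * h2 s L).

Lemma moment_poly_derive h : moment_poly h ->
  exists2 h', moment_poly h' &
    forall s (L : R), 0 < L -> is_derive L 1 (h s) (h' s L).
Proof.
elim=> {h} [c||m||h1 h2 hh1 [h1' mh1 dh1] hh2 [h2' mh2 dh2]
                |h1 h2 hh1 [h1' mh1 dh1] hh2 [h2' mh2 dh2]].
- by exists (fun _ _ => 0); [exact: MomentConst|move=> s L _; exact: is_derive_cst].
- by exists (fun _ _ => 0); [exact: MomentConst|move=> s L _; exact: is_derive_cst].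
- by exists (fun _ L => phi m.+1 L); [exact: MomentPhi|move=> s; exact: phi_derive].
- exists (fun _ L => -1 * (phi 1%N L * ((phi 0%N L)^-1 * (phi 0%N L)^-1))).
    apply: MomentMul (MomentConst _) _; apply: MomentMul (MomentPhi _) _.
    exact: MomentMul MomentInv MomentInv.
  move=> s L L0; have p0 := phi_gt0 L0.
  have pn0 : phi 0%N L != 0 by rewrite gt_eqF.
  have dphi := phi_derive 0%N L0.
  apply: DeriveDef; first by apply: derivableV.
  by rewrite deriveV// derive_val /GRing.scale /= expr2 invfM mulrC; ring.
- exists (fun s L => h1' s L + h2' s L); first exact: MomentAdd.
  by move=> s L L0; apply: is_deriveD; [exact: dh1|exact: dh2].
- exists (fun s L => h1 s L * h2' s L + h2 s L * h1' s L).
    by apply: MomentAdd; apply: MomentMul.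
  by move=> s L L0; apply: is_deriveM; [exact: dh1|exact: dh2].
Qed.

Lemma moment_poly_horner h : moment_poly h ->
  forall L, exists p : {poly R}, forall s, h s L = p.[s].
Proof.
move=> + L; elim=> {h} [c||m||h1 h2 _ [p1 e1] _ [p2 e2]|h1 h2 _ [p1 e1] _ [p2 e2]].
- by exists c%:P => s; rewrite hornerC.
- by exists 'X => s; rewrite hornerX.
- by exists (phi m L)%:P => s; rewrite hornerC.
- by exists (phi 0%N L)^-1%:P => s; rewrite hornerC.
- by exists (p1 + p2) => s; rewrite hornerD e1 e2.
- by exists (p1 * p2) => s; rewrite hornerM e1 e2.
Qed.

Variable f : R -> R.
Hypothesis phi0E : forall L, 0 < L -> expR (- f L) = phi 0%N L.

Lemma is_derive_laplace_exponent (L : R) : 0 < L ->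
  is_derive L 1 f (- (phi 1%N L * (phi 0%N L)^-1)).
Proof.
move=> L0; apply: (@near_eq_is_derive _ _ _ (fun x => - ln (phi 0%N x))).
- near=> x.
  rewrite -phi0E ?expRK ?opprK//; near: x; exact: lt_nbhsr.
- have dphi := phi_derive 0%N L0; have p0 := phi_gt0 L0.
  have dln := is_derive1_ln p0.
  apply: is_deriveN; rewrite mulrC.
  exact: (is_derive1_comp dln dphi).
Unshelve. all: by end_near. Qed.

(** By induction on m: if the m-th derivative is h * exp (- s f), the next one is
    (h' - s f' h) * exp (- s f). It matters that s ranges over all reals:
    the derivative of passage_sum at s = 0 is two-sided, whereas exp (- s f)
    is a Laplace transform for s >= 0 only. *)
Lemma derive1n_expR_laplace_exponent m : exists2 h, moment_poly h &
  forall s (L : R), 0 < L ->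
    derive1n m (fun x => expR (- (s * f x))) L = h s L * expR (- (s * f L)) /\
    derivable (derive1n m (fun x => expR (- (s * f x)))) L 1.
Proof.
have dE s (L : R) : 0 < L -> is_derive L 1 (fun x => expR (- (s * f x)))
    (s * (phi 1%N L * (phi 0%N L)^-1) * expR (- (s * f L))).
  move=> L0; have df := is_derive_laplace_exponent L0.
  have dg : is_derive L 1 (fun x => - (s * f x)) (s * (phi 1%N L * (phi 0%N L)^-1)).
    have := is_deriveN (@is_deriveZ _ _ _ f s L 1 _ df).
    by rewrite /GRing.scale /= mulrN opprK.
  by rewrite mulrC; exact: (is_derive1_comp (is_derive_expR _) dg).
(* h need not be known beforehand: this step gives both the formula for the
   next order and the derivability at the present one. *)
have step h m' : moment_poly h ->
    (forall s (L : R), 0 < L ->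
     derive1n m' (fun x => expR (- (s * f x))) L = h s L * expR (- (s * f L))) ->
    exists2 h', moment_poly h' & forall s (L : R), 0 < L ->
      is_derive L 1 (derive1n m' (fun x => expR (- (s * f x))))
        (h' s L * expR (- (s * f L))).
  move=> mh eh; have [h' mh' dh] := moment_poly_derive mh.
  exists (fun s L => h s L * (s * (phi 1%N L * (phi 0%N L)^-1)) + h' s L).
    apply: MomentAdd => //; apply: MomentMul => //; apply: MomentMul.
      exact: MomentTime.
    by apply: MomentMul; [exact: MomentPhi|exact: MomentInv].
  move=> s L L0.
  apply: (@near_eq_is_derive _ _ _ (fun x => h s x * expR (- (s * f x)))).
    by near=> x; rewrite eh//; near: x; exact: lt_nbhsr.
  have dhL := dh s L L0; have dEL := dE s L L0.
  have := is_deriveM dhL dEL; rewrite /GRing.scale /=.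
  by congr is_derive; ring.
have [h mh eh] : exists2 h, moment_poly h & forall s (L : R), 0 < L ->
    derive1n m (fun x => expR (- (s * f x))) L = h s L * expR (- (s * f L)).
  elim: m => [|m [h mh eh]].
    by exists (fun _ _ => 1); [exact: MomentConst|move=> s L _; rewrite mul1r].
  have [h' mh' dh] := step _ _ mh eh.
  exists h' => // s L L0; have [_ dv] := dh s L L0.
  by rewrite derive1nS derive1E.
exists h => // s L L0; split; first exact: eh.
have [h' _ dh] := step _ _ mh eh.
by have [] := dh s L L0.
Unshelve. all: by end_near. Qed.

Lemma passage_sum_horner k (lam : 'I_k -> R) n : 0 < \sum_(j < k) lam j ->
  exists p : {poly R}, forall s,
    passage_sum lam f n s = p.[s] * expR (- (s * f (\sum_(j < k) lam j))).
Proof.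
move=> L0; set L := \sum_(j < k) lam j in L0 *.
have /choice[p hp] m : exists p : {poly R}, forall s,
    derive1n m (fun x => expR (- (s * f x))) L = p.[s] * expR (- (s * f L)).
  have [h mh eh] := derive1n_expR_laplace_exponent m.
  have [p hp] := moment_poly_horner mh L.
  by exists p => s; rewrite -hp; have [] := eh s L L0.
exists (\sum_(l < n) \sum_(x in Omega k l)
    (\prod_(j < k) ((- lam j) ^+ x j / (x j)`!%:R)) *: p (\sum_(j < k) x j)%N).
move=> s; rewrite /passage_sum horner_sum big_distrl; apply: eq_bigr => l _ /=.
rewrite horner_sum big_distrl; apply: eq_bigr => x _ /=.
by rewrite hp hornerZ mulrA.
Qed.

End laplace_exponent.

(** * Density of a variable with a smooth survival function *)

Section generation.
Variable R : realType.

Definition lower_rays : set (set R) := [set A | exists x, A = `]-oo, x]%classic].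

Lemma lower_rays_generate :
  (measurable : set (set (measurableTypeR R))) = <<s lower_rays >>.
Proof.
rewrite [LHS]RGenOInfty.measurableE eqEsubset; split.
- apply: smallest_sub; first exact: smallest_sigma_algebra.
  move=> _ [x ->]; rewrite -setCitvl.
  have [_ sC _] := smallest_sigma_algebra setT lower_rays.
  by rewrite -setTD; apply: sC; apply: sub_sigma_algebra; exists x.
- apply: smallest_sub; first exact: smallest_sigma_algebra.
  move=> _ [x ->]; rewrite -setCitvr.
  have [_ sC _] := smallest_sigma_algebra setT (@RGenOInfty.G R).
  by rewrite -setTD; apply: sC; apply: sub_sigma_algebra; exists x.
Qed.

Lemma lower_rays_setI : setI_closed lower_rays.
Proof.
move=> _ _ [x ->] [y ->]; exists (Num.min x y).
by apply/seteqP; split => z /=; rewrite !in_itv /= le_min; [move=> [-> ->]|move/andP].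
Qed.

Lemma lower_rays_cover : \bigcup_n `]-oo, n%:R]%classic = [set: R].
Proof.
apply/seteqP; split => // x _; exists (Num.truncn x).+1 => //=.
by rewrite in_itv /= ltW// truncnS_gt.
Qed.

End generation.

Section density.
Context d (T : measurableType d) (R : realType) (P : probability T R).
Variables (Z : T -> \bar R) (F : R -> R).
Hypotheses (mZ : measurable_fun setT Z) (Z_ge0 : forall w, (0 <= Z w)%E).
Hypotheses (dF : forall s, 0 <= s -> derivable F s 1)
  (cF : continuous (derive1 F)).
Hypothesis survival : forall s, 0 <= s -> P [set w | (s%:E < Z w)%E] = (F s)%:E.
Hypothesis F0 : F 0 = 1.

(** The mass lost by this law is the probability that Z is infinite. *)
Definition finite_part_law (A : set (measurableTypeR R)) : \bar R :=
  P (Z @^-1` (EFin @` A)).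

Let law0 : finite_part_law set0 = 0%E.
Proof. by rewrite /finite_part_law image_set0 preimage_set0 measure0. Qed.

Let law_ge0 A : (0 <= finite_part_law A)%E.
Proof. exact: measure_ge0. Qed.

Let law_sigma_additive : semi_sigma_additive finite_part_law.
Proof.
move=> B mB tB mUB; rewrite /finite_part_law image_bigcup preimage_bigcup.
have mZB n : measurable (Z @^-1` (EFin @` B n)).
  rewrite -[X in measurable X]setTI; apply: mZ => //.
  exact: (measurable_image_EFin (mB n)).
apply: measure_semi_sigma_additive => //; last exact: bigcup_measurable.
apply/trivIsetP => i j _ _ ij; rewrite -subset0 => w [/= [x Bx xZ] [y By yZ]].
move/trivIsetP : tB => /(_ i j Logic.I Logic.I ij); rewrite -subset0; apply; split.
  exact: Bx.
by move: xZ; rewrite -yZ => -[->].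
Qed.

HB.instance Definition _ := isMeasure.Build _ _ _ finite_part_law
  law0 law_ge0 law_sigma_additive.

Definition survival_density s : R := if 0 <= s then - derive1 F s else 0.

Let F_nonincreasing s t : 0 <= s -> s <= t -> F t <= F s.
Proof.
move=> s0 st; have t0 := le_trans s0 st.
rewrite -lee_fin -(survival s0) -(survival t0).
apply: le_measure; rewrite ?inE.
- rewrite -[X in measurable X]setTI; exact: emeasurable_fun_o_infty.
- rewrite -[X in measurable X]setTI; exact: emeasurable_fun_o_infty.
- by move=> w /=; apply: le_lt_trans; rewrite lee_fin.
Qed.

(** The one-sided difference quotients suffice, which covers the boundary point
    s = 0, where F is only known to be monotone on the right. *)
Lemma survival_density_ge0 s : 0 <= survival_density s.
Proof.
rewrite /survival_density; case: ifPn => // s0; rewrite oppr_ge0.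
have /cvg_ex[l dl] := dF s0.
have -> : derive1 F s = l by rewrite derive1E; exact: cvg_lim.
have dlr : h^-1 *: (F (h *: 1 + s) - F s) @[h --> 0^'+] --> l.
  exact: cvg_dnbhs_at_right.
apply: (cvgr_to_le dlr); near=> h.
have h0 : 0 < h by near: h; exact: nbhs_right_gt.
rewrite /GRing.scale /= mulr1 pmulr_rle0 ?invr_gt0// subr_le0.
by apply: F_nonincreasing => //; rewrite lerDr ltW.
Unshelve. all: by end_near. Qed.

Lemma measurable_survival_density : measurable_fun setT survival_density.
Proof.
apply: measurable_fun_ifT => //.
- exact: measurable_fun_ler.
- by apply: measurableT_comp => //; exact: continuous_measurable_fun.
Qed.

(** Fundamental theorem of calculus for - F on [0, x]; the two half-lines
    ]-oo, x] and [0, +oo[ meet in [0, x], a point or the empty set. *)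
Lemma integral_survival_density (x : R) :
  (\int[@lebesgue_measure R]_(s in `]-oo, x]) (survival_density s)%:E)%E =
  P [set w | (Z w <= x%:E)%E].
Proof.
have mgt : measurable [set w | (x%:E < Z w)%E].
  by rewrite -[X in measurable X]setTI; exact: emeasurable_fun_o_infty.
have -> : (fun s => (survival_density s)%:E) =
    (fun s => (- derive1 F s)%:E) \_ `[0, +oo[.
  apply/funext => s; rewrite /survival_density patchE mem_setE in_itv /= andbT.
  by case: ifP.
rewrite -integral_mkcondr.
have [x0|x0] := ltP x 0.
  have -> : `]-oo, x]%classic `&` `[0, +oo[%classic = set0.
    apply/seteqP; split => // s /=; rewrite !in_itv /= andbT => -[sx s0].
    by have := le_lt_trans (le_trans s0 sx) x0; rewrite ltxx.
  have -> : [set w | (Z w <= x%:E)%E] = set0.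
    apply/seteqP; split => // w /= Zx.
    by have := le_trans (Z_ge0 w) Zx; rewrite lee_fin leNgt x0.
  by rewrite integral_set0 measure0.
have -> : `]-oo, x]%classic `&` `[0, +oo[%classic = `[0, x]%classic.
  by apply/seteqP; split => s /=; rewrite !in_itv /= andbT; [move=> [-> ->]|move=> /andP[-> ->]].
have -> : [set w | (Z w <= x%:E)%E] = ~` [set w | (x%:E < Z w)%E].
  by apply/seteqP; split => w /=; rewrite leNgt; [move=> /negP|move=> /negP].
rewrite probability_setC// survival//.
move: x0; rewrite le_eqVlt => /predU1P[<-|x0].
  by rewrite set_itv1 integral_set1 F0 subee.
have -> : (1 - (F x)%:E = (- F x)%:E - (- F 0)%:E)%E.
  by rewrite F0 -EFinD -!EFinN -EFinD; congr EFin; lra.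
have cFs s : 0 <= s -> {for s, continuous F}.
  by move=> s0; apply: differentiable_continuous; apply/derivable1_diffP/dF.
apply: (@continuous_FTC2 _ _ (- F)) => //.
- by apply: continuous_subspaceT => s; apply: continuousN; exact: cF.
- split.
  + move=> s; rewrite in_itv /= => /andP[/ltW s0 _].
    by apply: derivableN; exact: dF.
  + by apply: cvg_at_right_filter; apply: continuousN; exact: cFs.
  + by apply: cvg_at_left_filter; apply: continuousN; exact/cFs/ltW.
- move=> s; rewrite in_itv /= => /andP[/ltW s0 _].
  by rewrite !derive1E deriveN//; exact: dF.
Qed.

(** Two finite measures that agree on the rays ]-oo, x] are equal. The rays are
    closed under intersection, generate the Borel sets and exhaust the line. *)
Lemma has_density_survival : has_density P Z survival_density.
Proof.
split; [exact: mZ|exact: measurable_survival_density|exact: survival_density_ge0|].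
move=> A mA.
pose mu2 (A : set (measurableTypeR R)) : \bar R :=
  (\int[@lebesgue_measure R]_(x in A) (survival_density x)%:E)%E.
have mu20 : mu2 set0 = 0%E by rewrite /mu2 integral_set0.
have mu2_ge0 B : (0 <= mu2 B)%E.
  by apply: integral_ge0 => s _; rewrite lee_fin survival_density_ge0.
have mu2_add : semi_sigma_additive mu2.
  apply: semi_sigma_additive_nng_induced.
    apply/measurable_EFinP. exact: measurable_survival_density.
  by move=> s; rewrite lee_fin survival_density_ge0.
pose m2M := isMeasure.Build _ _ _ mu2 mu20 mu2_ge0 mu2_add.
pose m2 : {measure set (measurableTypeR R) -> \bar R} := HB.pack mu2 m2M.
apply: (@measure_unique _ R (measurableTypeR R) (@lower_rays R)
   (fun n => `]-oo, n%:R]%classic) (@lower_rays_generate R) (@lower_rays_setI R) _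
   (@lower_rays_cover R) finite_part_law m2) => //.
- by move=> i; exists i%:R.
- move=> _ [x ->]; rewrite /= /mu2 integral_survival_density /finite_part_law.
  congr (P _); apply/seteqP; split => w /=.
    by move=> [y]; rewrite in_itv /= => yx <-; rewrite lee_fin.
  have := Z_ge0 w; case: (Z w) => // r _; rewrite lee_fin => rx.
  by exists r; rewrite // in_itv.
- move=> i; apply: le_lt_trans (ltry 1); apply: probability_le1.
  rewrite -[X in measurable X]setTI; apply: mZ => //.
  exact: (measurable_image_EFin (measurable_itv _)).
Qed.

End density.

(** * Evaluation at an independent random time *)

Section right_grid.
Variable R : realType.
Implicit Types (t s : R) (m j : nat).

(** The least point of the grid of mesh 1 / (m + 1) strictly above t, for
    t >= 0: approaching t strictly from the right is what a right-continuous
    path requires. *)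
Definition right_grid m t : R := (Num.truncn (t * m.+1%:R)).+1%:R / m.+1%:R.

Definition grid_cell m j : set R := `[j%:R / m.+1%:R, j.+1%:R / m.+1%:R[%classic.

Lemma right_grid_gt m t : t < right_grid m t.
Proof. by rewrite /right_grid ltr_pdivlMr// truncnS_gt. Qed.

Lemma right_grid_ge0 m t : 0 <= right_grid m t.
Proof. by rewrite divr_ge0. Qed.

Lemma right_grid_le m t : 0 <= t -> right_grid m t <= t + m.+1%:R^-1.
Proof.
move=> t0; rewrite /right_grid -[X in _ + X]div1r -[in leRHS](@mulfK _ m.+1%:R _ t)//.
by rewrite -mulrDl ler_pM2r ?invr_gt0// -natr1 lerD2r truncn_le mulr_ge0.
Qed.

Lemma right_grid_homo m s t : s <= t -> right_grid m s <= right_grid m t.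
Proof.
move=> st; rewrite ler_pM2r ?invr_gt0// ler_nat ltnS.
by apply: le_truncn; rewrite ler_pM2r.
Qed.

Lemma right_grid_cell m j t : grid_cell m j t -> right_grid m t = j.+1%:R / m.+1%:R.
Proof.
rewrite /grid_cell /= in_itv /= => /andP[jt tj]; rewrite /right_grid.
by rewrite (@truncn_def _ _ j)// -ler_pdivrMr// jt -ltr_pdivlMr.
Qed.

Lemma grid_cell_trunc m t : 0 <= t -> grid_cell m (Num.truncn (t * m.+1%:R)) t.
Proof.
move=> t0; rewrite /grid_cell /= in_itv /= ler_pdivrMr// ltr_pdivlMr//.
by rewrite truncn_le mulr_ge0//= truncnS_gt.
Qed.

Lemma grid_cell_trivIset m : trivIset setT (grid_cell m).
Proof.
move=> i j _ _ [t [ti tj]]; apply/eqP.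
have /eqP := right_grid_cell tj; rewrite (right_grid_cell ti).
by rewrite (inj_eq (mulIf _)) ?invr_eq0// eqr_nat eqSS.
Qed.

Lemma cvg_right_grid t : 0 <= t -> right_grid^~ t @ \oo --> t^'+.
Proof.
move=> t0 A [e /= e0 eA]; suff: \forall m \near \oo, A (right_grid m t) by [].
near=> m.
have mt := right_grid_gt m t.
apply: eA => //=; rewrite distrC ger0_norm ?subr_ge0 ?ltW//.
rewrite ltrBlDl (le_lt_trans (right_grid_le _ _))// ltrD2l.
by near: m; exact: near_infty_natSinv_lt (PosNum e0).
Unshelve. all: by end_near. Qed.

End right_grid.

Section random_time.
Context d (T : measurableType d) (R : realType) (P : probability T R).
Variables (E : R -> set T) (q : R -> R) (S : T -> R).
Hypotheses (mS : measurable_fun setT S) (S_ge0 : forall w, 0 <= S w).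
Hypothesis E_right : forall t w, 0 <= t -> \forall s \near t^'+, E s w <-> E t w.
Hypothesis mE : forall t, 0 <= t -> measurable (E t).
Hypothesis PE : forall t, 0 <= t -> P (E t) = (q t)%:E.
Hypothesis cq : continuous q.
Hypothesis indE : forall t (B : set R), 0 <= t -> measurable B ->
  P (E t `&` S @^-1` B) = (P (E t) * P (S @^-1` B))%E.

Let A m : set T := [set w | E (right_grid m (S w)) w].

Let A_cell m : A m =
  \bigcup_j (E (j.+1%:R / m.+1%:R) `&` S @^-1` grid_cell m j).
Proof.
apply/seteqP; split => w /=.
  move=> Aw; exists (Num.truncn (S w * m.+1%:R)) => //.
  by split => //=; exact: grid_cell_trunc.
by move=> [j _ [Ej cj]]; rewrite /A /= (right_grid_cell cj).
Qed.

Let mcell m j : measurable (S @^-1` grid_cell m j).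
Proof. by rewrite -[X in measurable X]setTI; apply: mS => //; exact: measurable_itv. Qed.

Let mA m : measurable (A m).
Proof.
rewrite A_cell; apply: bigcup_measurable => j _; apply: measurableI => //.
by apply: mE; rewrite divr_ge0.
Qed.

Let tcell m : trivIset setT (fun j => S @^-1` grid_cell m j).
Proof.
move=> i j _ _ [w [wi wj]]; apply: (@grid_cell_trivIset R m) => //.
by exists (S w).
Qed.

Let cover m : \bigcup_j (S @^-1` grid_cell m j) = setT.
Proof.
apply/seteqP; split => // w _; exists (Num.truncn (S w * m.+1%:R)) => //=.
exact: grid_cell_trunc.
Qed.

Let q01 t : 0 <= t -> 0 <= q t <= 1.
Proof.
move=> t0; rewrite -!lee_fin -PE// measure_ge0/=.
by apply: probability_le1; exact: mE.
Qed.

Let mq_grid m : measurable_fun setT (fun w => q (right_grid m (S w))).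
Proof.
apply: measurableT_comp; first exact: continuous_measurable_fun.
apply: measurableT_comp => //; apply: nondecreasing_measurable => //.
exact: right_grid_homo.
Qed.

Let PA m : P (A m) = (\int[P]_w (q (right_grid m (S w)))%:E)%E.
Proof.
rewrite -[in RHS](cover m) ge0_integral_bigcup//=; last first.
- by move=> w _; rewrite lee_fin; have /andP[] := q01 (right_grid_ge0 m (S w)).
- by rewrite cover; apply/measurable_EFinP; exact: mq_grid.
rewrite A_cell measure_semi_bigcup//; last first.
- by rewrite -A_cell.
- by apply: trivIset_setIl; exact: tcell.
- by move=> j; apply: measurableI => //; apply: mE; rewrite divr_ge0.
apply: eq_eseriesr => j _; have t0 : 0 <= j.+1%:R / m.+1%:R :> R by rewrite divr_ge0.
transitivity ((\int[P]_(w in S @^-1` grid_cell m j) (q (j.+1%:R / m.+1%:R))%:E)%E).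
  rewrite integral_cst//.
  have := @indE _ (grid_cell m j) t0 (measurable_itv _).
  by rewrite PE.
by apply: eq_integral => w /set_mem cw; rewrite (right_grid_cell cw).
Qed.

Let cvgA w : \1_(A m) w @[m --> \oo] --> (\1_[set w | E (S w) w] w : R).
Proof.
apply: (@cvg_near_cst nat R _ _ \oo).
have AE : \forall m \near \oo, E (right_grid m (S w)) w <-> E (S w) w.
  exact: cvg_right_grid (E_right w (S_ge0 w)).
apply: filterS AE => m AE; rewrite !indicE; congr (nat_of_bool _)%:R.
by apply/idP/idP => /set_mem h; apply/mem_set; apply/AE.
Qed.

(** The event is the limit of its discretizations A m, which are countable unions
    over the values of the grid point. *)
Lemma measurable_random_time : measurable [set w | E (S w) w].
Proof.
apply/measurable_indicP.
apply: (@measurable_fun_cvg _ _ _ setT (fun m => \1_(A m) : T -> R)).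
  by move=> m; apply: measurable_indic; exact: mA.
by move=> w _; exact: cvgA.
Qed.

(** For the discretized time the formula is the law of total probability, since
    on each cell independence turns the probability into a product. Dominated
    convergence passes to the limit on both sides: the indicators are
    eventually constant by right continuity of E, and q is continuous. *)
Lemma probability_random_time :
  P [set w | E (S w) w] = (\int[P]_w (q (S w))%:E)%E.
Proof.
have int1 : P.-integrable setT (EFin \o cst (1 : R) : T -> \bar R).
  exact: finite_measure_integrable_cst.
have lim1 : P (A m) @[m --> \oo] --> P [set w | E (S w) w].
  have PI B : measurable B -> P B = (\int[P]_w (\1_B w)%:E)%E.
    by move=> mB; rewrite integral_indic// setIT.
  rewrite PI; last exact: measurable_random_time.
  under eq_fun do rewrite PI//.
  apply: (dominated_cvg measurableT _ _ _ int1) => //.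
  - by move=> m; apply/measurable_EFinP; exact: measurable_indic.
  - by move=> w _; apply: cvg_EFin; [exact: nearW|exact: cvgA].
  - by move=> m w _; rewrite /= lee_fin indicE; case: (_ \in _); rewrite ?normr1 ?normr0.
have lim2 : P (A m) @[m --> \oo] --> (\int[P]_w (q (S w))%:E)%E.
  under eq_fun do rewrite PA.
  apply: (dominated_cvg measurableT _ _ _ int1) => //.
  - by move=> m; apply/measurable_EFinP; exact: mq_grid.
  - move=> w _; apply: cvg_EFin; first exact: nearW.
    apply: (cvg_comp _ _ (cvg_right_grid (S_ge0 w))).
    by apply: cvg_at_right_filter; exact: cq.
  - move=> m w _; have /andP[q0 q1] := q01 (right_grid_ge0 m (S w)).
    by rewrite /= lee_fin ger0_norm.
exact: (cvg_unique _ lim1 lim2).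
Qed.

End random_time.

(** * Paths and distribution of the generalized counting process *)

Lemma probability_eq_outside d (T : measurableType d) (R : realType)
    (P : probability T R) (A B N : set T) :
  measurable A -> measurable B -> P.-negligible N ->
  (forall w, ~ N w -> A w <-> B w) -> P A = P B.
Proof.
move=> mA mB [N' [mN' N'0 NN']] AB.
have le C C' : measurable C -> measurable C' ->
    (forall w, ~ N w -> C w -> C' w) -> (P C <= P C')%E.
  move=> mC mC' CC'; rewrite -[leRHS]adde0 -N'0.
  apply: le_trans (measureU2 _ mC' mN'); apply: le_measure; rewrite ?inE//.
    exact: measurableU.
  move=> w Cw; have [/NN' Nw|Nw] := pselect (N w); [by right|].
  by left; exact: CC'.
by apply/eqP; rewrite eq_le !le// => w Nw; rewrite AB.
Qed.

Section gcp_paths.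
Context d (T : measurableType d) (R : realType) (P : probability T R).
Variables (k : nat) (lam : 'I_k -> R) (M : R -> T -> nat).
Hypothesis hM : generalized_counting_process P lam M.

(** A right limit of integers is eventually attained. *)
Lemma gcp_right_constant t w : 0 <= t -> \forall s \near t^'+, M s w = M t w.
Proof.
move=> t0; have [/(_ t t0) + _] := levy_cadlag (gcp_levy hM) w.
move=> /cvgrPdist_lt /(_ 1 ltr01); apply: filterS => s /=.
rewrite ltr_norml => /andP[lo hi].
by case: (ltngtP (M t w) (M s w)) => // ms; exfalso; move: ms; rewrite -(ler_nat R) -natr1; lra.
Qed.

Lemma gcp_event_measurable t (Q : set nat) : 0 <= t ->
  measurable [set w | Q (M t w)].
Proof.
move=> t0; have -> : [set w | Q (M t w)] =
    \bigcup_(n in Q) ((fun w => (M t w)%:R : R) @^-1` [set n%:R]).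
  apply/seteqP; split => w /=; first by move=> Qw; exists (M t w).
  by move=> [n Qn /= /eqP]; rewrite eqr_nat => /eqP ->.
apply: bigcup_measurable => n _; rewrite -[X in measurable X]setTI.
exact: (levy_measurable (gcp_levy hM) t0).
Qed.

Definition gcp_cdf n t : R :=
  \sum_(l < n) \sum_(x in Omega k l)
    (\prod_(j < k) ((lam j * t) ^+ x j / (x j)`!%:R)) *
     expR (- ((\sum_(j < k) lam j) * t)).

Lemma gcp_cdfE n t : 0 <= t -> P [set w | (M t w < n)%N] = (gcp_cdf n t)%:E.
Proof.
move=> t0; elim: n => [|n IHn].
  rewrite /gcp_cdf big_ord0 [X in P X](_ : _ = set0) ?measure0//.
  by apply/seteqP; split => w.
have -> : [set w | (M t w < n.+1)%N] =
    [set w | (M t w < n)%N] `|` [set w | M t w = n].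
  apply/seteqP; split => w /=.
    by rewrite ltnS leq_eqVlt => /predU1P[|]; [right|left].
  by move=> [/ltnW|->].
transitivity (P [set w | (M t w < n)%N] + P [set w | M t w = n])%E; last first.
  by rewrite IHn (gcp_law hM)// -EFinD /gcp_cdf big_ord_recr.
apply: measureU.
- exact: (gcp_event_measurable [set m | (m < n)%N]).
- exact: (gcp_event_measurable [set n]).
- by apply/seteqP; split => // w [/= + Mw]; rewrite Mw ltnn.
Qed.

(** The signs of the statement come from here: (lam t)^x = (- lam)^x (- t)^x, and
    (- t)^z exp (- L t) is the z-th derivative of exp (- L t) in L. *)
Lemma gcp_cdf_expand n t : gcp_cdf n t =
  \sum_(l < n) \sum_(x in Omega k l)
    (\prod_(j < k) ((- lam j) ^+ x j / (x j)`!%:R)) *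
     ((- t) ^+ (\sum_(j < k) x j)%N * expR (- ((\sum_(j < k) lam j) * t))).
Proof.
apply: eq_bigr => l _; apply: eq_bigr => x _; rewrite mulrA; congr (_ * _).
rewrite -prodrXr -big_split; apply: eq_bigr => j _ /=.
by rewrite mulrAC -exprMn mulrNN.
Qed.

Lemma gcp_cdf_continuous n : continuous (gcp_cdf n).
Proof.
pose p : {poly R} := \sum_(l < n) \sum_(x in Omega k l)
    (\prod_(j < k) ((- lam j) ^+ x j / (x j)`!%:R)) *: (- 'X) ^+ (\sum_(j < k) x j)%N.
have -> : gcp_cdf n =
    fun t => p.[t] * expR (- ((\sum_(j < k) lam j) * t)).
  apply/funext => t; rewrite gcp_cdf_expand.
  move: (\sum_(j < k) lam j) => L; rewrite horner_sum mulr_suml.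
  apply: eq_bigr => l _; rewrite horner_sum mulr_suml; apply: eq_bigr => x _ /=.
  by rewrite hornerZ horner_exp hornerN hornerX mulrA.
move=> t; apply: cvgM; first exact: continuous_horner.
apply: continuous_comp; last exact: continuous_expR.
by apply: cvgN; apply: cvgM; [exact: cvg_cst|exact: cvg_id].
Qed.

(** The paths that decrease between two points of a common grid. Countably many
    comparisons suffice because paths are right-continuous. *)
Definition grid_descent : set T :=
  \bigcup_m \bigcup_i \bigcup_j
    [set w | (M (i%:R / m.+1%:R + j%:R / m.+1%:R) w < M (i%:R / m.+1%:R) w)%N].

(** By stationarity the increment over [s, s + t] has the law of M t, which is a
    natural number and hence never negative. *)
Lemma negligible_grid_descent : P.-negligible grid_descent.
Proof.
apply: negligible_bigcup => m; apply: negligible_bigcup => i.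
apply: negligible_bigcup => j.
have i0 : 0 <= i%:R / m.+1%:R :> R by rewrite divr_ge0.
have j0 : 0 <= j%:R / m.+1%:R :> R by rewrite divr_ge0.
have mneg : measurable (`]-oo, 0[%classic : set R) by exact: measurable_itv.
have := levy_stationary (gcp_levy hM) i0 j0 mneg.
set s : R := i%:R / m.+1%:R; set t : R := j%:R / m.+1%:R.
have -> : ((fun w => (M (s + t) w)%:R - (M s w)%:R : R) @^-1` `]-oo, 0[) =
    [set w | (M (s + t) w < M s w)%N].
  by apply/seteqP; split => w /=; rewrite in_itv /= subr_lt0 ltr_nat.
have -> : ((fun w => (M t w)%:R : R) @^-1` `]-oo, 0[) = set0.
  by apply/seteqP; split => w //=; rewrite in_itv /= ltNge ler0n.
rewrite measure0 => PN; apply/negligibleP => //.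
have -> : [set w | (M (s + t) w < M s w)%N] =
   (fun w => (M (s + t) w)%:R - (M s w)%:R : R) @^-1` `]-oo, 0[.
  by apply/seteqP; split => w /=; rewrite in_itv /= subr_lt0 ltr_nat.
rewrite -[X in measurable X]setTI.
have mM := levy_measurable (gcp_levy hM).
by apply: measurable_funB => //; apply: mM; rewrite ?addr_ge0.
Qed.

(** The same grid serves for s and t, so that their right approximations are
    compared by the absence of descents; both values are eventually exact. *)
Lemma gcp_nondecreasing w s t : ~ grid_descent w -> 0 <= s -> s <= t ->
  (M s w <= M t w)%N.
Proof.
move=> Nw s0 st; have t0 := le_trans s0 st.
have /filter_ex[m [ms mt]] : \forall m \near \oo,
    M (right_grid m s) w = M s w /\ M (right_grid m t) w = M t w.
  near=> m; split; near: m.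
    exact: cvg_right_grid (gcp_right_constant w s0).
  exact: cvg_right_grid (gcp_right_constant w t0).
rewrite -ms -mt leqNgt; apply/negP => lt_ts; apply: Nw.
have := right_grid_homo m st; move: lt_ts; rewrite /right_grid.
move: (Num.truncn (s * _)).+1 (Num.truncn (t * _)).+1 => i j lt_ts.
rewrite ler_pM2r ?invr_gt0// ler_nat => ij.
exists m => //; exists i => //; exists (j - i)%N => //=.
by rewrite -mulrDl -natrD subnKC.
Unshelve. all: by end_near. Qed.

End gcp_paths.

(** * The subordinated process and its first passage times *)

Section finite_sums.
Context d (T : measurableType d) (R : realType) (mu : {measure set T -> \bar R}).
Variables (I : Type) (g : I -> T -> R).
Hypothesis int_g : forall i, mu.-integrable [set: T] (EFin \o g i).

Lemma integrable_sum_EFin (r : seq I) (Q : pred I) :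
  mu.-integrable [set: T] (EFin \o (fun w => \sum_(i <- r | Q i) g i w)).
Proof.
have -> : EFin \o (fun w => \sum_(i <- r | Q i) g i w) =
    (fun w => \sum_(i <- r | Q i) (g i w)%:E)%E.
  by apply/funext => w /=; rewrite sumEFin.
by apply: integrable_sum => // i _; exact: int_g.
Qed.

Lemma Rintegral_sum (r : seq I) (Q : pred I) :
  \int[mu]_(w in [set: T]) (\sum_(i <- r | Q i) g i w) =
  \sum_(i <- r | Q i) \int[mu]_(w in [set: T]) g i w.
Proof.
elim: r => [|i r IHr].
  rewrite big_nil; under eq_Rintegral do rewrite big_nil.
  by rewrite Rintegral_cst// mul0r.
rewrite big_cons -IHr; under eq_Rintegral do rewrite big_cons.
by case: ifPn => // Qi; rewrite RintegralD//; exact: integrable_sum_EFin.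
Qed.

End finite_sums.

Section subordination.
Context d (T : measurableType d) (R : realType) (P : probability T R).
Variables (k : nat) (lam : 'I_k -> R) (M : R -> T -> nat).
Hypotheses (hk : (0 < k)%N) (hlam : forall j, 0 < lam j).
Hypothesis hM : generalized_counting_process P lam M.
Variables (f : R -> R) (D : R -> T -> R).
Hypothesis hD : levy_subordinator P f D.

Lemma total_rate_gt0 : 0 < \sum_(j < k) lam j.
Proof.
rewrite (bigD1 (Ordinal hk))//= ltr_pwDl// sumr_ge0// => j _.
exact: ltW.
Qed.

Lemma subordinator_ge0 t w : 0 <= t -> 0 <= D t w.
Proof.
move=> t0; rewrite -(levy_start (subordinator_levy hD) w).
exact: (subordinator_nondecreasing hD).
Qed.

Let mD t : 0 <= t -> measurable_fun setT (D t).
Proof. exact: (levy_measurable (subordinator_levy hD)). Qed.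

Lemma laplace_moment0E s L : 0 <= s -> 0 <= L ->
  laplace_moment P (D s) 0 L = expR (- (s * f L)).
Proof.
move=> s0 L0; have := subordinator_laplace hD L0 s0.
rewrite unlock /laplace_moment /Rintegral => eqL.
under eq_integral do rewrite expr0 mul1r.
by rewrite eqL.
Qed.

(** Both sides have the same derivative in L, starting from
    E exp (- L D(s)) = exp (- s f L). *)
Lemma derive1n_laplace m s L : 0 <= s -> 0 < L ->
  derive1n m (fun x => expR (- (s * f x))) L = laplace_moment P (D s) m L.
Proof.
move=> s0; elim: m L => [|m IHm] L L0.
  by rewrite laplace_moment0E// ltW.
rewrite derive1nS derive1E.
have [_ <-] : is_derive L 1 (laplace_moment P (D s) m) (laplace_moment P (D s) m.+1 L).
  apply: is_derive_laplace_moment => //; first exact: mD.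
  by move=> w; exact: subordinator_ge0.
apply: near_eq_derive.
by near=> x; apply: IHm; near: x; exact: lt_nbhsr.
Unshelve. all: by end_near. Qed.

(** Termwise expectation of gcp_cdf_expand at the time D(s). *)
Lemma passage_sumE n s : 0 <= s ->
  (\int[P]_w (gcp_cdf lam n (D s w))%:E)%E = (passage_sum lam f n s)%:E.
Proof.
move=> s0; set L := \sum_(j < k) lam j; have L0 : 0 < L := total_rate_gt0.
pose c (l : nat) (x : {ffun 'I_k -> 'I_l.+1}) : R :=
  \prod_(j < k) ((- lam j) ^+ x j / (x j)`!%:R).
pose g l (x : {ffun 'I_k -> 'I_l.+1}) w : R :=
  c l x * ((- D s w) ^+ (\sum_(j < k) x j)%N * expR (- (L * D s w))).
have intm m : P.-integrable setT
    (EFin \o (fun w => (- D s w) ^+ m * expR (- (L * D s w)))).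
  apply: integrable_laplace => //; first exact: mD.
  by move=> w; exact: subordinator_ge0.
have intg l x : P.-integrable setT (EFin \o g l x).
  by apply: (integrableZl measurableT (c l x) (intm _)).
have cdfE w : gcp_cdf lam n (D s w) =
    \sum_(l < n) \sum_(x in Omega k l) g l x w by rewrite gcp_cdf_expand.
have intS (l : 'I_n) : P.-integrable setT
    (EFin \o (fun w => \sum_(x in Omega k l) g l x w)).
  exact: integrable_sum_EFin.
under eq_integral do rewrite cdfE.
rewrite -[LHS]fineK; last first.
  apply: integrable_fin_num => //; exact: (integrable_sum_EFin intS).
congr EFin; rewrite -/(Rintegral _ _ _) (Rintegral_sum intS).
apply: eq_bigr => l _; rewrite (Rintegral_sum (intg l)).
apply: eq_bigr => x _; rewrite derive1n_laplace// /laplace_moment.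
by rewrite -RintegralZl.
Qed.

Local Notation N := (time_changed M D).

(** D is nondecreasing, so that D u tends to D s from the right, or stays at D s. *)
Lemma time_changed_right_constant s w : 0 <= s ->
  \forall u \near s^'+, N u w = N s w.
Proof.
move=> s0; have [e /= e0 Me] := gcp_right_constant hM w (subordinator_ge0 w s0).
have [/(_ s s0) + _] := levy_cadlag (subordinator_levy hD) w.
move=> /cvgrPdist_lt /(_ e e0) near_e; near=> u.
have su : s <= u by near: u; exact: nbhs_right_ge.
have := subordinator_nondecreasing hD w s0 su.
rewrite le_eqVlt => /predU1P[Dsu|Dsu]; first by rewrite /time_changed Dsu.
by apply: Me => //=; near: u.
Unshelve. all: by end_near. Qed.

Lemma time_changed_nondecreasing w s t : ~ grid_descent M w ->
  0 <= s -> s <= t -> (N s w <= N t w)%N.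
Proof.
move=> Nw s0 st; apply: (gcp_nondecreasing hM Nw); first exact: subordinator_ge0.
exact: (subordinator_nondecreasing hD).
Qed.

(** Right continuity moves a time at which level n is reached to a later grid
    point before r; this makes the passage time measurable on every path, not
    only almost surely. *)
Lemma first_passage_ltP n w r : reflect
  (exists m i, i%:R / m.+1%:R < r /\ (n <= N (i%:R / m.+1%:R) w)%N)
  (first_passage N n w < r%:E)%E.
Proof.
apply: (iffP ereal_inf_ltP) => [[_ [s [s0 ns] <-]]|[m [i [ir ni]]]].
  rewrite lte_fin => sr.
  have /filter_ex[m [mr mN]] : \forall m \near \oo,
      right_grid m s < r /\ N (right_grid m s) w = N s w.
    near=> m; split; near: m.
      exact: cvg_right_grid (nbhs_right_lt sr).
    exact: cvg_right_grid (time_changed_right_constant w s0).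
  by exists m, (Num.truncn (s * m.+1%:R)).+1; split; rewrite // mN.
exists (i%:R / m.+1%:R)%:E; last by rewrite lte_fin.
by exists (i%:R / m.+1%:R) => //; split => //; rewrite divr_ge0.
Unshelve. all: by end_near. Qed.

(** By right continuity, being below n at s persists until some u > s, and by
    monotonicity it held before; hence the infimum is at least u. *)
Lemma first_passage_gtE n w s : ~ grid_descent M w -> 0 <= s ->
  (s%:E < first_passage N n w)%E <-> (N s w < n)%N.
Proof.
move=> Nw s0; split=> [sT|Nsn].
  rewrite ltnNge; apply/negP => nN; move: sT; rewrite ltNge => /negP; apply.
  by apply: ereal_inf_lbound; exists s.
have /filter_ex[u [su uN]] : \forall u \near s^'+, s < u /\ N u w = N s w.
  by near=> u; split; near: u; [exact: nbhs_right_gt|exact: time_changed_right_constant].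
apply: (@lt_le_trans _ _ u%:E); first by rewrite lte_fin.
apply/ereal_infP => _ [v [v0 nv] <-]; rewrite lee_fin leNgt; apply/negP => vu.
have := time_changed_nondecreasing Nw v0 (ltW vu).
by rewrite uN leqNgt (leq_trans Nsn nv).
Unshelve. all: by end_near. Qed.

Lemma first_passage_ge0 n w : (0 <= first_passage N n w)%E.
Proof. by apply/ereal_infP => _ [s [s0 _] <-]; rewrite lee_fin. Qed.

Hypothesis hMD : independent_processes P (fun t w => (M t w)%:R) D.

(** Conditioning on D(s), which is independent of M. *)
Lemma time_changed_cdf n s : 0 <= s ->
  measurable [set w | (N s w < n)%N] /\
  P [set w | (N s w < n)%N] = (passage_sum lam f n s)%:E.
Proof.
move=> s0; pose E t := [set w | (M t w < n)%N].
have Er t w : 0 <= t -> \forall u \near t^'+, E u w <-> E t w.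
  move=> t0; apply: filterS (gcp_right_constant hM w t0) => u Mu.
  by rewrite /E /= Mu.
have mE t : 0 <= t -> measurable (E t).
  by move=> t0; exact: (gcp_event_measurable hM [set m | (m < n)%N]).
have PE t : 0 <= t -> P (E t) = (gcp_cdf lam n t)%:E by exact: gcp_cdfE.
have Ds_ge0 w : 0 <= D s w by exact: subordinator_ge0.
have cq : continuous (gcp_cdf lam n) by exact: gcp_cdf_continuous.
have indE t (B : set R) : 0 <= t -> measurable B ->
    P (E t `&` D s @^-1` B) = (P (E t) * P (D s @^-1` B))%E.
  move=> t0 mB; apply: hMD; apply: sub_sigma_algebra.
    exists t, `]-oo, n%:R[%classic; split => //.
    by apply/seteqP; split => w; rewrite /E /= in_itv /= ltr_nat.
  by exists s, B; split.
split; first exact: (measurable_random_time (mD s0) Ds_ge0 Er mE).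
by rewrite -(passage_sumE n s0) -(probability_random_time (mD s0) Ds_ge0 Er mE PE cq indE).
Qed.

Lemma measurable_first_passage n : measurable_fun setT (first_passage N n).
Proof.
apply: (measurability _ (ErealGenInftyO.measurableE R)) => // _ /= [_ [r ->] <-].
rewrite setTI; have -> : first_passage N n @^-1` `]-oo, r%:E[ =
    \bigcup_m \bigcup_i (if i%:R / m.+1%:R < r
      then ~` [set w | (N (i%:R / m.+1%:R) w < n)%N] else set0).
  apply/seteqP; split => w /=; rewrite in_itv /=.
    move=> /first_passage_ltP[m [i [ir ni]]]; exists m => //; exists i => //=.
    by rewrite ir /= => /=; rewrite ltnNge ni.
  move=> [m _ [i _]]; case: ifPn => // ir /= ni; apply/first_passage_ltP.
  by exists m, i; split => //; rewrite leqNgt; apply/negP.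
apply: bigcup_measurable => m _; apply: bigcup_measurable => i _.
case: ifPn => // _; apply: measurableC.
by have [] := @time_changed_cdf n (i%:R / m.+1%:R); first by rewrite divr_ge0.
Qed.

Lemma first_passage_survival n s : 0 <= s ->
  P [set w | (s%:E < first_passage N n w)%E] = (passage_sum lam f n s)%:E.
Proof.
move=> s0; have [mN <-] := time_changed_cdf n s0.
apply: (probability_eq_outside _ mN (negligible_grid_descent hM)).
  rewrite -[X in measurable X]setTI; apply: emeasurable_fun_o_infty => //.
  exact: measurable_first_passage.
by move=> w Nw; exact: first_passage_gtE.
Qed.

End subordination.

(** If f L <= 0 then 1 - exp (- L D(1)) is nonnegative with zero expectation, so
    that D(1) = 0 almost surely and the Laplace transform of D(1) is 1
    everywhere, that is, f = 0. *)
Lemma laplace_exponent_gt0 d (T : measurableType d) (R : realType)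
    (P : probability T R) (f : R -> R) (D : R -> T -> R) (L : R) :
  levy_subordinator P f D -> 0 < L -> (exists2 s, 0 <= s & f s != 0) -> 0 < f L.
Proof.
move=> hD L0 [s s0]; apply: contraNT; rewrite -leNgt => fL0.
have D1_ge0 w : 0 <= D 1 w by exact: (subordinator_ge0 hD).
have mD1 := levy_measurable (subordinator_levy hD) ler01.
have mE (x : R) : measurable_fun setT (fun w => expR (- (x * D 1 w))).
  apply: measurableT_comp => //; apply: measurableT_comp => //.
  exact: measurable_funM.
have E x : 0 <= x -> (\int[P]_w (expR (- (x * D 1 w)))%:E)%E = (expR (- f x))%:E.
  by move=> x0; have := subordinator_laplace hD x0 ler01; rewrite unlock mul1r.
pose g w : R := 1 - expR (- (L * D 1 w)).
have g_ge0 w : 0 <= g w.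
  by rewrite subr_ge0 -[leRHS]expR0 ler_expR oppr_le0 mulr_ge0// ltW.
have mg : measurable_fun setT (EFin \o g).
  by apply/measurable_EFinP; exact: measurable_funB.
have intE : P.-integrable setT (EFin \o (fun w => expR (- (L * D 1 w)))).
  have -> : (fun w => expR (- (L * D 1 w))) =
      (fun w => (- D 1 w) ^+ 0 * expR (- (L * D 1 w))).
    by apply/funext => w; rewrite expr0 mul1r.
  exact: integrable_laplace.
have int1 : (\int[P]_(w in [set: T]) 1%:E)%E = 1%:E.
  by rewrite integral_cst// mul1e; exact: probability_setT.
have g0 : (\int[P]_w `|(EFin \o g) w|)%E = 0%E.
  under eq_integral do rewrite /= (ger0_norm (g_ge0 _)).
  apply/eqP; rewrite eq_le integral_ge0 ?andbT; last by move=> w _; rewrite lee_fin.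
  under eq_integral do rewrite EFinB.
  rewrite integralB//; last exact: finite_measure_integrable_cst.
  rewrite int1 (E _ (ltW L0)) -EFinB lee_fin.
  by rewrite subr_le0 -expR0 ler_expR oppr_ge0.
have /(ae_eq_integral_abs _ measurableT mg) ae0 := g0.
have : (\int[P]_w (expR (- (s * D 1 w)))%:E)%E = (\int[P]_w 1%:E)%E.
  apply: ae_eq_integral => //; first by apply/measurable_EFinP; exact: mE.
  apply: filterS ae0 => w /(_ Logic.I) /= [] /eqP.
  rewrite subr_eq0 eq_sym -[eqbRHS]expR0 => /eqP /expR_inj /eqP.
  rewrite oppr_eq0 mulf_eq0 (gt_eqF L0)/=.
  by move=> /eqP -> _; rewrite mulr0 oppr0 expR0.
rewrite E// int1 => -[].
by rewrite -expR0 => /expR_inj /eqP; rewrite oppr_eq0.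
Qed.

(** * The density of the first passage time *)

(* The first two conclusions say that the derivatives of orders z_k <= n - 1 in
   Lambda and the derivative in s exist. The last one says that the density is
   not defective unless f = 0, in which case D and M_f vanish and T is +oo. *)
Theorem mainTheorem12 (R : realType) (d : measure_display)
    (T : measurableType d) (P : probability T R)
    (k : nat) (hk : (0 < k)%N) (lam : 'I_k -> R) (hlam : forall j, 0 < lam j)
    (M : R -> T -> nat) (hM : generalized_counting_process P lam M)
    (f : R -> R) (D : R -> T -> R) (hD : levy_subordinator P f D)
    (hMD : independent_processes P (fun t w => (M t w)%:R) D)
    (n : nat) (hn : (1 <= n)%N) :
  [/\ forall (m : nat) (s L : R), (m.+1 < n)%N -> 0 <= s -> 0 < L ->
        derivable (derive1n m (fun L' => expR (- (s * f L')))) L 1,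
      forall s : R, 0 <= s -> derivable (passage_sum lam f n) s 1,
      has_density P (first_passage (time_changed M D) n)
        (fun s => if 0 <= s then - derive1 (passage_sum lam f n) s else 0) &
      (exists2 s : R, 0 <= s & f s != 0) ->
        P [set w | first_passage (time_changed M D) n w = +oo%E] = 0%E].
Proof.
have D1_ge0 w : 0 <= D 1 w by exact: (subordinator_ge0 hD).
have mD1 := levy_measurable (subordinator_levy hD) ler01.
pose phi := laplace_moment P (D 1).
have dphi m (L : R) : 0 < L -> is_derive L 1 (phi m) (phi m.+1 L).
  exact: is_derive_laplace_moment.
have phi0E L : 0 < L -> expR (- f L) = phi 0%N L.
  by move=> /ltW L0; rewrite /phi (laplace_moment0E hD ler01 L0) mul1r.
have phi_gt0 L : 0 < L -> 0 < phi 0%N L.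
  by move=> L0; rewrite -phi0E// expR_gt0.
have L0 := total_rate_gt0 hk hlam.
have [p pE] := passage_sum_horner dphi phi_gt0 phi0E n L0.
set L := \sum_(j < k) lam j in L0 pE.
have FE : passage_sum lam f n = fun s => p.[s] * expR (- (s * f L)).
  by apply/funext => s; rewrite pE.
have dF s : derivable (passage_sum lam f n) s 1.
  by rewrite FE; have [] := is_derive_exp_poly p (f L) s.
have survival s : 0 <= s ->
    P [set w | (s%:E < first_passage (time_changed M D) n w)%E] =
    (passage_sum lam f n s)%:E.
  exact: first_passage_survival.
have mT := measurable_first_passage hk hlam hM hD hMD n.
have T_ge0 := first_passage_ge0 M D n.
have cF : continuous (derive1 (passage_sum lam f n)).
  have -> : derive1 (passage_sum lam f n) =
      fun s => (p^`() - f L *: p).[s] * expR (- (s * f L)).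
    apply/funext => s; rewrite derive1E FE.
    by have [] := is_derive_exp_poly p (f L) s.
  exact: continuous_exp_poly.
have F0 : passage_sum lam f n 0 = 1.
  have [_] := time_changed_cdf hk hlam hM hD hMD n (lexx 0).
  rewrite [X in P X](_ : _ = setT) ?probability_setT; first by case.
  apply/seteqP; split => // w _ /=; rewrite /time_changed.
  rewrite (levy_start (subordinator_levy hD)).
  have /eqP := levy_start (gcp_levy hM) w.
  by rewrite pnatr_eq0 => /eqP ->.
split => //.
- move=> m s x _ _ x0.
  have [h _ /(_ s x x0) []//] := derive1n_expR_laplace_exponent dphi phi_gt0 phi0E m.
- exact: (has_density_survival mT T_ge0 (fun s _ => dF s) cF survival F0).
- move=> fn0; have [C CE] := exp_poly_bounded ('X * p) (laplace_exponent_gt0 hD L0 fn0).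
  set A := [set w | _ = +oo%E].
  have mA : measurable A.
    rewrite -[X in measurable X]setTI; apply: (mT measurableT [set +oo%E]).
    exact: emeasurable_set1.
  (* s * P(T = +oo) <= s * P(T > s) is bounded in s, which excludes
     P(T = +oo) > 0: take s = (C + 1) / P(T = +oo). *)
  have sA s : 0 <= s -> s * fine (P A) <= C.
    move=> s0; apply: le_trans (CE s s0).
    rewrite hornerM hornerX -mulrA ler_wpM2l// -pE -lee_fin -survival//.
    rewrite fineK ?fin_num_measure//; apply: le_measure; rewrite ?inE//.
      rewrite -[X in measurable X]setTI; exact: emeasurable_fun_o_infty.
    by move=> w /= ->; rewrite ltry.
  rewrite -[LHS]fineK ?fin_num_measure//; congr EFin.
  apply/eqP; rewrite eq_le fine_ge0 ?andbT ?measure_ge0// leNgt; apply/negP => PA0.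
  have C0 : 0 <= C by have := sA 0 (lexx 0); rewrite mul0r.
  have := sA ((C + 1) / fine (P A)); rewrite divr_ge0 ?addr_ge0 ?(ltW PA0)//.
  by move=> /(_ isT); rewrite divfK ?gt_eqF//; lra.
Qed.
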